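(* Let $\beta>1$ and $\varepsilon>0$ be fixed. Then there is a number $a(\beta,\varepsilon)>0$ (strictly bigger than zero) such that $$\Bigl\{h_0\in\mathbb{R} : \exists\,\lambda\in\mathbb{R} \text{ with } \lim_{N\uparrow\infty}\hat K_{\lambda;\beta,\varepsilon,h_0,N}(d\eta)=\mathbb{P}(d\eta)\Bigr\}=\mathbb{R}\setminus\bigl[-a(\beta,\varepsilon),+a(\beta,\varepsilon)\bigr],$$ where $\lim$ denotes a weak limit.
   Context: For $N\ge 1$, spins $\sigma_i\in\{-1,+1\}$ and random fields $\eta_i\in\{-1,+1\}$, $i=1,\dots,N$, the Morita-approximant measure is the probability measure on $\{-1,1\}^N\times\{-1,1\}^N$ $$\hat K_{\lambda;\beta,\varepsilon,h_0,N}(\sigma_{[1,N]},\eta_{[1,N]})=\frac{\exp\Bigl(\frac{\beta}{2N}\bigl(\sum_{i=1}^N\sigma_i\bigr)^2+\beta\sum_{i=1}^N(\varepsilon\eta_i+h_0)\sigma_i+\lambda\sum_{i=1}^N\eta_i\Bigr)}{Z_{\lambda;\beta,\varepsilon,h_0,N}},$$ where $Z_{\lambda;\beta,\varepsilon,h_0,N}$ is the normalizing constant (sum of the numerator over all $\sigma_{[1,N]},\eta_{[1,N]}$). Here $\beta$ is the inverse temperature, $\varepsilon$ the strength of the random fields, $h_0$ an external field and $\lambda$ the Morita chemical potential. $\hat K_{\lambda;\beta,\varepsilon,h_0,N}(d\eta)$ denotes the marginal of this measure on $\eta=\eta_{[1,N]}$. $\mathbb{P}$ is the distribution of i.i.d.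 $\eta_i$, $i\ge1$, taking values $\pm1$ with probability $1/2$ each. Weak convergence of the $\eta$-marginals means that for each fixed $N_0$ the distribution of $\eta_{[1,N_0]}=(\eta_1,\dots,\eta_{N_0})$ converges as $N\uparrow\infty$ to the corresponding marginal of the limit measure. *)

(* Defs.v *)
From mathcomp Require Import all_boot all_order all_algebra.
From mathcomp Require Import all_classical all_reals all_analysis.
Import Order.TTheory GRing.Theory Num.Theory numFieldNormedType.Exports.

Set Implicit Arguments.
Unset Strict Implicit.
Unset Printing Implicit Defensive.

Local Open Scope classical_set_scope.
Local Open Scope ring_scope.

(* Elements of {-1,+1}^N are boolean vectors, [true] standing for +1. *)
Definition config (N : nat) := {ffun 'I_N -> bool}.

Definition spin (R : realType) (b : bool) : R := if b then 1 else -1.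

Section MoritaApproximant.
Context {R : realType}.
Variables (lambda beta eps h0 : R).

Definition morita_weight (N : nat) (sigma eta : config N) : R :=
  expR (beta / (2 * N%:R) * (\sum_(i < N) spin R (sigma i)) ^+ 2
        + beta * \sum_(i < N) (eps * spin R (eta i) + h0) * spin R (sigma i)
        + lambda * \sum_(i < N) spin R (eta i)).

Definition morita_Z (N : nat) : R :=
  \sum_(sigma : config N) \sum_(eta : config N) morita_weight sigma eta.

Definition morita_K (N : nat) (sigma eta : config N) : R :=
  morita_weight sigma eta / morita_Z N.

Definition morita_K_eta (N : nat) (eta : config N) : R :=
  \sum_(sigma : config N) morita_K sigma eta.

End MoritaApproximant.

(* The law of the first N0 fields under PP: a product of fair coins. *)
Definition iid_marginal (R : realType) (N0 : nat) (xi : config N0) : R :=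
  \prod_(i < N0) bernoulli_pmf (2^-1 : R) (xi i).

(* (eta_1, ..., eta_N0) as a function of (eta_1, ..., eta_N) with N = n.+1;
   it is meaningful only for N0 <= N ([inord] is a junk value beyond), which
   holds eventually as n tends to infinity. *)
Definition first_fields (N0 n : nat) (eta : config n.+1) : config N0 :=
  [ffun i : 'I_N0 => eta (inord i)].

(* For every N0, the law of (eta_1, ..., eta_N0) under mu N converges weakly
   to its law under nu as N tends to infinity. The space config N0 is finite
   and discrete, so every real function on it is bounded continuous. Sizes N
   start at 1, hence the index n.+1. *)
Definition weak_cvg_marginals (R : realType)
    (mu : forall N : nat, config N -> R)
    (nu : forall N0 : nat, config N0 -> R) : Prop :=
  forall (N0 : nat) (f : config N0 -> R),
    (\sum_(eta : config n.+1) mu n.+1 eta * f (first_fields N0 eta))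
      @[n --> \oo] --> \sum_(xi : config N0) nu N0 xi * f xi.

(* Main.v *)
(* Summing out [eta] given [sigma] turns the Morita measure into a Curie-Weiss
   measure on [sigma] with field [h = beta * h0 + c(lambda)], under which the
   fields are conditionally independent with mean [tanh (lambda + beta * eps *
   sigma_i)], an affine function of [sigma_i].  Exchangeability then shows that
   the [eta]-marginals converge to fair coins iff the magnetization concentrates
   at the point [m] where this affine function vanishes.

   Since [sigma_i] has conditional mean [tanh (beta * (cavity / N) + h)], the
   defect [x - tanh (beta * x + h)] of the magnetization [x] is [O(1/N)] in
   mean square, so that [x] can only concentrate at a solution of the mean-field
   equation.  If [h > 0] it does so at the positive solution, because negative
   magnetizations are exponentially penalized;
     if [h = 0] it does not concentrate
   at all, because [beta > 1].  Hence [h0] is admissible iff for some [lambda]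
   one has [m = tanh (beta * m + h)] with [m] and [h] of the same strict sign.

   With [y := beta * m + h > 0], the unknowns [m] and [lambda] become functions
   of [y], and [beta * h0 = (y - beta * tanh y) - c(lambda(y))].  The condition
   [h > 0] says that [y] exceeds the positive root [y*] of [y = beta * tanh y];
   on that half-line the right-hand side increases continuously to infinity from
   its value at [y*], which is [beta * a > 0]. *)
Require Import Defs.
From mathcomp Require Import all_boot perm all_order all_algebra ring lra.
From mathcomp Require Import all_classical all_reals all_analysis.
Import Order.TTheory GRing.Theory Num.Theory numFieldNormedType.Exports.

Set Implicit Arguments.
Unset Strict Implicit.
Unset Printing Implicit Defensive.

Local Open Scope classical_set_scope.
Local Open Scope ring_scope.

(** * Hyperbolic tangent *)

Section Tanh.
Context {R : realType}.
Implicit Types x y z : R.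

Definition tanh y : R := (expR y - expR (- y)) / (expR y + expR (- y)).

Lemma expRDN_gt0 y : 0 < expR y + expR (- y) :> R.
Proof. by rewrite addr_gt0 ?expR_gt0. Qed.

Lemma tanhN y : tanh (- y) = - tanh y.
Proof. by rewrite /tanh opprK -mulNr opprB [X in _ / X]addrC. Qed.

Lemma tanh0 : tanh 0 = 0.
Proof. by rewrite /tanh oppr0 subrr mul0r. Qed.

Lemma ltr1_tanh y : tanh y < 1.
Proof.
by rewrite /tanh ltr_pdivrMr ?expRDN_gt0// mul1r; have := expR_gt0 (- y); lra.
Qed.

Lemma gtrN1_tanh y : -1 < tanh y.
Proof. by rewrite ltrNl -tanhN ltr1_tanh. Qed.

Lemma normr_tanh_le1 y : `|tanh y| <= 1.
Proof. by rewrite ler_norml !ltW// ?ltr1_tanh ?gtrN1_tanh. Qed.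

Lemma is_derive_expRDN y :
  is_derive y 1 (fun t : R => expR t + expR (- t)) (expR y - expR (- y)).
Proof. by apply: is_derive_eq; rewrite /GRing.scale/=; ring. Qed.

Lemma is_derive_expRBN y :
  is_derive y 1 (fun t : R => expR t - expR (- t)) (expR y + expR (- y)).
Proof. by apply: is_derive_eq; rewrite /GRing.scale/=; ring. Qed.

Lemma is_derive_tanh y : is_derive y 1 tanh (1 - tanh y ^+ 2).
Proof.
have e0 : expR y + expR (- y) != 0 by rewrite gt_eqF ?expRDN_gt0.
have dn := is_derive_expRBN y.
have dV :=
  is_deriveV (f := fun t : R => expR t + expR (- t)) e0 (is_derive_expRDN y).
have dT : is_derive y 1 tanh _ := is_deriveM dn dV.
apply: is_derive_eq.
rewrite /GRing.scale /= /tanh -exprVn.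
by field.
Qed.

Lemma derivable_tanh y : derivable tanh y 1.
Proof. by have [] := is_derive_tanh y. Qed.

Lemma continuous_tanh : continuous tanh.
Proof.
move=> y.
exact/differentiable_continuous/derivable1_diffP/derivable_tanh.
Qed.

Lemma tanh_MVT y z : y < z ->
  exists2 c, y < c < z & tanh z - tanh y = (1 - tanh c ^+ 2) * (z - y).
Proof.
move=> yz; have [||c] := MVT (f := tanh) (df := fun t => 1 - tanh t ^+ 2) yz.
- by move=> t _; exact: is_derive_tanh.
- exact/continuous_subspaceT/continuous_tanh.
by rewrite in_itv => cyz ->; exists c.
Qed.

Lemma sqr_tanh_lt1 y : tanh y ^+ 2 < 1.
Proof. by have := ltr1_tanh y; have := gtrN1_tanh y; nra. Qed.

Lemma ltr_tanh y z : y < z -> tanh y < tanh z.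
Proof.
move=> yz; have [c _ e] := tanh_MVT yz.
by rewrite -subr_gt0 e mulr_gt0 ?subr_gt0// sqr_tanh_lt1.
Qed.

Lemma ler_tanh y z : y <= z -> tanh y <= tanh z.
Proof. by rewrite le_eqVlt => /predU1P[->//|/ltr_tanh/ltW]. Qed.

Lemma tanh_gt0 y : 0 < y -> 0 < tanh y.
Proof. by move=> y0; rewrite -tanh0 ltr_tanh. Qed.

Lemma tanh_lipschitz y z : `|tanh y - tanh z| <= `|y - z|.
Proof.
wlog yz : y z / z < y.
  move=> H; case: (ltgtP y z) => [|/H//|->]; last by rewrite !subrr.
  by rewrite distrC (distrC y) => /H.
rewrite !gtr0_norm ?subr_gt0 ?ltr_tanh//; have [c _ ->] := tanh_MVT yz.
by rewrite ler_piMl ?subr_ge0 ?(ltW yz)// gerBl sqr_ge0.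
Qed.

(* strict concavity: the difference quotient on [0, y] exceeds that on [y, z] *)
Lemma ltr_tanh_slope y z : 0 < y -> y < z -> tanh z * y < tanh y * z.
Proof.
move=> y0 yz; have [c /andP[c0 cy]] := tanh_MVT y0.
rewrite tanh0 !subr0 => e1; have [d /andP[yd dz] e2] := tanh_MVT yz.
have cd : tanh c ^+ 2 < tanh d ^+ 2.
  have := ltr_tanh (lt_trans cy yd); have := tanh_gt0 c0; nra.
rewrite -subr_gt0.
have -> : tanh y * z - tanh z * y =
    (z - y) * tanh y - y * (tanh z - tanh y) by ring.
rewrite e2 e1.
have -> : (z - y) * ((1 - tanh c ^+ 2) * y) - y * ((1 - tanh d ^+ 2) * (z - y))
  = (z - y) * y * (tanh d ^+ 2 - tanh c ^+ 2) by ring.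
by rewrite !mulr_gt0 ?subr_gt0.
Qed.

(** After clearing denominators this is [1 + 2 * y <= exp (2 * y)]. It serves to locate a point
    where [beta * tanh y] lies above [y]. *)
Lemma ler_divD1_tanh y : 0 < y -> y / (1 + y) <= tanh y.
Proof.
move=> y0; have y1 : 0 < 1 + y by lra.
rewrite /tanh ler_pdivrMr// mulrAC ler_pdivlMr ?expRDN_gt0//.
suff : (1 + (y + y)) * expR (- y) <= expR y by nra.
by rewrite expRN ler_pdivrMr ?expR_gt0// -expRD expR_ge1Dx.
Qed.

Lemma tanhE_sqr y : tanh y = (expR (2 * y) - 1) / (expR (2 * y) + 1).
Proof.
have -> : 2 * y = y + y by ring.
rewrite /tanh expRD expRN; have /gt_eqF/negbT y0 := expR_gt0 y.
by field; rewrite y0/= -expr2 gt_eqF// addr_gt0// exprn_gt0// expR_gt0.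
Qed.

(** [exp y + exp (- y) - 2] is the square of [exp (y / 2) - exp (- y / 2)], which for [y > 0] is at
    least [y] by the mean value theorem. *)
Lemma sqr_le_expRDN y : 2 + y ^+ 2 <= expR y + expR (- y).
Proof.
wlog y0 : y / 0 < y.
  move=> H; have [/H//|y0|<-] := ltgtP 0 y; last first.
    by rewrite oppr0 expR0 expr0n addr0.
  by rewrite -sqrrN addrC -{2}(opprK y) addrC [leRHS]addrC H ?oppr_gt0.
have u0 : 0 < y / 2 by rewrite divr_gt0.
have [||c _ /=] := MVT (f := fun t : R => expR t - expR (- t))
    (df := fun t => expR t + expR (- t)) u0.
- by move=> t _; exact: is_derive_expRBN.
- apply/continuous_subspaceT => t.
  apply/differentiable_continuous/derivable1_diffP.
  by have [] := is_derive_expRBN t.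
have ge2 : 2 <= expR c + expR (- c).
  have := expRxMexpNx_1 c; have := expR_gt0 c; have := expR_gt0 (- c).
  have := sqr_ge0 (expR c - expR (- c)); nra.
rewrite oppr0 expR0 subrr !subr0 => e.
have : y <= expR (y / 2) - expR (- (y / 2)) by rewrite e; nra.
have -> : expR y = expR (y / 2) ^+ 2 by rewrite expr2 -expRD -splitr.
have -> : expR (- y) = expR (- (y / 2)) ^+ 2.
  by rewrite expr2 -expRD -opprD -splitr.
have := expRxMexpNx_1 (y / 2); nra.
Qed.

End Tanh.

(** * Curie-Weiss measure *)

Section CurieWeiss.
Context {R : realType}.
Variable beta : R.
Implicit Types (h : R) (N : nat).

Definition total_spin N (sigma : config N) : R := \sum_(i < N) spin R (sigma i).

Definition magn N (sigma : config N) : R := total_spin sigma / N%:R.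

Definition cw_weight h N (sigma : config N) : R :=
  expR (beta / (2 * N%:R) * total_spin sigma ^+ 2 + h * total_spin sigma).

Definition cw_Z h N : R := \sum_(sigma : config N) cw_weight h sigma.

Definition cw_E h N (f : config N -> R) : R :=
  (\sum_(sigma : config N) cw_weight h sigma * f sigma) / cw_Z h N.

Lemma cw_weight_gt0 h N (sigma : config N) : 0 < cw_weight h sigma.
Proof. exact: expR_gt0. Qed.

Lemma cw_Z_gt0 h N : 0 < cw_Z h N.
Proof.
rewrite /cw_Z (bigD1 [ffun=> true])//= ltr_wpDr ?cw_weight_gt0//.
by apply: sumr_ge0 => sigma _; exact/ltW/cw_weight_gt0.
Qed.

Lemma cw_E_cst h N (c : R) : cw_E h (fun _ : config N => c) = c.
Proof. by rewrite /cw_E -mulr_suml mulrAC divff ?mul1r// gt_eqF ?cw_Z_gt0. Qed.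

Lemma cw_ED h N (f g : config N -> R) :
  cw_E h (fun sigma => f sigma + g sigma) = cw_E h f + cw_E h g.
Proof.
rewrite /cw_E -mulrDl -big_split/=; congr (_ / _).
by apply: eq_bigr => *; rewrite mulrDr.
Qed.

Lemma cw_EZ h N (c : R) (f : config N -> R) :
  cw_E h (fun sigma => c * f sigma) = c * cw_E h f.
Proof.
rewrite /cw_E mulrA mulr_sumr; congr (_ / _).
by apply: eq_bigr => *; rewrite mulrCA.
Qed.

Lemma cw_E_sum h N (I : finType) (F : I -> config N -> R) :
  cw_E h (fun sigma => \sum_i F i sigma) = \sum_i cw_E h (F i).
Proof.
rewrite /cw_E -mulr_suml exchange_big/=; congr (_ / _).
by apply: eq_bigr => *; rewrite mulr_sumr.
Qed.

Lemma eq_cw_E h N (f g : config N -> R) : f =1 g -> cw_E h f = cw_E h g.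
Proof. by move=> fg; rewrite /cw_E; under eq_bigr do rewrite fg. Qed.

Lemma ler_cw_E h N (f g : config N -> R) :
  (forall sigma, f sigma <= g sigma) -> cw_E h f <= cw_E h g.
Proof.
move=> fg; rewrite /cw_E ler_pM2r ?invr_gt0 ?cw_Z_gt0//.
by apply: ler_sum => sigma _; rewrite ler_pM2l ?cw_weight_gt0.
Qed.

Lemma cw_E_ge0 h N (f : config N -> R) :
  (forall sigma, 0 <= f sigma) -> 0 <= cw_E h f.
Proof. by move=> f0; rewrite -(cw_E_cst h N 0) ler_cw_E. Qed.

(** The variance of [f] is nonnegative. *)
Lemma sqr_cw_E_le h N (f : config N -> R) :
  cw_E h f ^+ 2 <= cw_E h (fun sigma => f sigma ^+ 2).
Proof.
set m := cw_E h f.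
have : 0 <= cw_E h (fun sigma => (f sigma - m) ^+ 2).
  by apply: cw_E_ge0 => sigma; exact: sqr_ge0.
rewrite (eq_cw_E _ (g := fun sigma =>
    f sigma ^+ 2 + ((- (2 * m)) * f sigma + m ^+ 2))).
  by rewrite !cw_ED cw_EZ cw_E_cst -/m; nra.
by move=> sigma; ring.
Qed.

(** Two fields appear because a symmetry may change the field: transpositions of sites keep it, the
    global flip reverses it. *)
Lemma cw_E_reindex h h' N (g : config N -> config N) (f : config N -> R) :
    injective g -> (forall sigma, cw_weight h (g sigma) = cw_weight h' sigma) ->
  cw_E h f = cw_E h' (fun sigma => f (g sigma)).
Proof.
move=> g_inj gw; rewrite /cw_E /cw_Z; congr (_ / _);
  by rewrite (reindex_inj g_inj); apply: eq_bigr => sigma _; rewrite gw.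
Qed.

(** * Exchangeability and the global flip *)

Definition transpose N (i j : 'I_N) (sigma : config N) : config N :=
  [ffun k => sigma (tperm i j k)].

Lemma transpose_inj N (i j : 'I_N) : injective (transpose i j).
Proof.
apply: inv_inj => sigma; apply/ffunP => k; by rewrite !ffunE tpermK.
Qed.

(** Exchangeability: the weight depends on the configuration only through its total spin. *)
Lemma cw_E_transpose h N (i j : 'I_N) (f : config N -> R) :
  cw_E h (fun sigma => f (transpose i j sigma)) = cw_E h f.
Proof.
rewrite [RHS](cw_E_reindex f (@transpose_inj N i j) (h' := h))// => sigma.
suff -> : cw_weight h (transpose i j sigma) = cw_weight h sigma by [].
rewrite /cw_weight.
suff -> : total_spin (transpose i j sigma) = total_spin sigma by [].
rewrite /total_spin [RHS](reindex_inj (@perm_inj _ (tperm i j))).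
by apply: eq_bigr => k _; rewrite ffunE.
Qed.

Definition flip N (sigma : config N) : config N := [ffun k => ~~ sigma k].

Lemma spinN b : spin R (~~ b) = - spin R b.
Proof. by case: b; rewrite /= ?opprK. Qed.

Lemma total_spin_flip N (sigma : config N) :
  total_spin (flip sigma) = - total_spin sigma.
Proof.
by rewrite /total_spin -sumrN; apply: eq_bigr => k _; rewrite ffunE spinN.
Qed.

Lemma magn_flip N (sigma : config N) : magn (flip sigma) = - magn sigma.
Proof. by rewrite /magn total_spin_flip mulNr. Qed.

Lemma flip_inj N : injective (@flip N).
Proof. by apply: inv_inj => sigma; apply/ffunP => k; rewrite !ffunE negbK. Qed.

Lemma cw_E_flip h N (f : config N -> R) :
  cw_E (- h) f = cw_E h (fun sigma => f (flip sigma)).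
Proof.
apply: cw_E_reindex => [|sigma]; first exact: flip_inj.
by rewrite /cw_weight total_spin_flip sqrrN mulrNN.
Qed.

(** * Flipping one spin, and its conditional mean *)

Definition flip_at N (i : 'I_N) (sigma : config N) : config N :=
  [ffun k => if k == i then ~~ sigma k else sigma k].

Lemma flip_at_inj N (i : 'I_N) : injective (flip_at i).
Proof.
by apply: inv_inj => sigma; apply/ffunP => k; rewrite !ffunE; case: eqP;
  rewrite ?negbK.
Qed.

Definition cavity N (i : 'I_N) (sigma : config N) : R :=
  total_spin sigma - spin R (sigma i).

Lemma cavityE N (i : 'I_N) (sigma : config N) :
  cavity i sigma = \sum_(k < N | k != i) spin R (sigma k).
Proof. by rewrite /cavity /total_spin (bigD1 i)//= addrAC subrr add0r. Qed.

Lemma cavity_flip_at N (i : 'I_N) (sigma : config N) :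
  cavity i (flip_at i sigma) = cavity i sigma.
Proof.
by rewrite !cavityE; apply: eq_bigr => k /negbTE ki; rewrite ffunE ki.
Qed.

(* Given the other spins, [sigma i] has mean
   [tanh (beta * cavity i sigma / N + h)]. *)
Lemma cw_E_cavity h N (i : 'I_N) (F : R -> R) :
  cw_E h (fun sigma : config N =>
    (spin R (sigma i) - tanh (beta * (cavity i sigma / N%:R) + h))
    * F (cavity i sigma)) = 0.
Proof.
set f := fun sigma => _.
(* A configuration and its flip at [i] share the same cavity, and their two contributions cancel. *)
have flip_cancel sigma : cw_weight h sigma * f sigma +
    cw_weight h (flip_at i sigma) * f (flip_at i sigma) = 0.
  rewrite /f cavity_flip_at ffunE eqxx spinN !(mulrA (cw_weight _ _)) -mulrDl.
  suff -> : cw_weight h sigma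
      * (spin R (sigma i) - tanh (beta * (cavity i sigma / N%:R) + h)) +
    cw_weight h (flip_at i sigma)
      * (- spin R (sigma i) - tanh (beta * (cavity i sigma / N%:R) + h)) = 0.
    by rewrite mul0r.
  (* The weight splits into a function of the cavity and the exponential of [sigma i] times its
     local field; the [+ 1] is the square of the spin. *)
  have weightE (tau : config N) : cw_weight h tau =
      expR (beta / (2 * N%:R) * (cavity i tau ^+ 2 + 1) + h * cavity i tau)
      * expR (spin R (tau i) * (beta * (cavity i tau / N%:R) + h)).
    have N0 : N%:R != 0 :> R by rewrite pnatr_eq0;
        case: N i tau {f sigma} => // -[].
    rewrite -expRD /cw_weight.
    have -> : total_spin tau = cavity i tau + spin R (tau i) by rewrite subrK.
    by congr expR; case: (tau i) => /=; field.
  rewrite !weightE cavity_flip_at ffunE eqxx spinN -!mulrA -mulrDr.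
  set v := beta * (cavity i sigma / N%:R) + h.
  apply/eqP; rewrite mulf_eq0; apply/orP; right; apply/eqP; rewrite /tanh.
  have := expRDN_gt0 v; rewrite lt0r => /andP[v0 _].
  by case: (sigma i) => /=; rewrite ?opprK ?mulN1r ?mul1r; field.
have e : \sum_(sigma : config N) cw_weight h sigma * f sigma = 0.
  apply/eqP; rewrite -[_ == 0](mulrn_eq0 _ 2)/= mulr2n.
  rewrite [X in _ + X](reindex_inj (@flip_at_inj N i))/= -big_split/=.
  by rewrite big1.
by rewrite /cw_E e mul0r.
Qed.

Lemma normr_total_spin_le N (sigma : config N) : `|total_spin sigma| <= N%:R.
Proof.
apply: le_trans (ler_norm_sum _ _ _) _.
rewrite -[leRHS]mulr1 mulr_natl -[N in leRHS]card_ord -sumr_const ler_sum// =>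
  i _.
by case: (sigma i); rewrite /= ?normrN normr1.
Qed.

Lemma normr_magn_le1 N (sigma : config N) : `|magn sigma| <= 1.
Proof.
(* At [N = 0] the inverse of zero is zero, so the magnetization is zero. *)
have [N0|N0] := posnP N.
  by rewrite /magn (_ : N%:R = 0 :> R) ?N0// invr0 mulr0 normr0.
rewrite /magn normrM normfV normr_nat ler_pdivrMr ?ltr0n// mul1r.
exact: normr_total_spin_le.
Qed.

(** * The mean-field defect *)

Definition mf_defect h x : R := x - tanh (beta * x + h).

Lemma mf_defect_lipschitz h (x y : R) : 0 <= beta ->
  `|mf_defect h x - mf_defect h y| <= (1 + beta) * `|x - y|.
Proof.
move=> b0; rewrite /mf_defect.
have -> : x - tanh (beta * x + h) - (y - tanh (beta * y + h)) =
  (x - y) + (tanh (beta * y + h) - tanh (beta * x + h)) by ring.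
apply: le_trans (ler_normD _ _) _; rewrite mulrDl mul1r lerD2l.
apply: le_trans (tanh_lipschitz _ _) _.
have -> : beta * y + h - (beta * x + h) = beta * (y - x) by ring.
by rewrite normrM ger0_norm// distrC.
Qed.

(** One factor of the square is written as an average over sites of spin minus tanh. Replacing the
    magnetization by [cavity / N] in both factors makes each expectation vanish by [cw_E_cavity].
    The factors are at most 2 and have Lipschitz constants [beta] and [1 + beta], so the error is at
    most [(2 * beta + 2 * (1 + beta)) / N]. *)
Lemma cw_E_mf_defect_le h N : (0 < N)%N -> 0 <= beta ->
  cw_E h (fun sigma : config N => mf_defect h (magn sigma) ^+ 2)
    <= (2 + 4 * beta) / N%:R.
Proof.
move=> N0 b0; have N0R : 0 < N%:R :> R by rewrite ltr0n.
have -> : cw_E h (fun sigma : config N => mf_defect h (magn sigma) ^+ 2) =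
    N%:R^-1 * \sum_(i < N) cw_E h (fun sigma : config N =>
      (spin R (sigma i) - tanh (beta * magn sigma + h))
        * mf_defect h (magn sigma)).
  rewrite -cw_E_sum -cw_EZ; apply: eq_cw_E => sigma.
  rewrite -mulr_suml sumrB sumr_const card_ord -/(total_spin sigma).
  rewrite expr2 mulrA; congr (_ * _); rewrite /mf_defect /magn -mulr_natl.
  by field; rewrite gt_eqF.
rewrite mulrC ler_pM2r ?invr_gt0//.
have -> : 2 + 4 * beta = \sum_(i < N) (2 + 4 * beta) / N%:R.
  by rewrite sumr_const card_ord -[RHS]mulr_natr divfK// gt_eqF.
apply: ler_sum => i _.
pose F (y : R) := mf_defect h (y / N%:R).
rewrite -[leRHS]add0r -(cw_E_cavity h i F).
rewrite -(cw_E_cst h N ((2 + 4 * beta) / N%:R)).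
rewrite -cw_ED; apply: ler_cw_E => sigma; rewrite /F.
set y := cavity i sigma / N%:R; set x := magn sigma.
set A := spin R (sigma i) - tanh (beta * x + h).
set A' := spin R (sigma i) - tanh (beta * y + h).
have s1 : `|spin R (sigma i)| = 1 by case: (sigma i); rewrite /= ?normrN normr1.
have xy : `|x - y| = N%:R^-1.
  rewrite /x /y /magn -mulrBl opprB addrC subrK normrM s1 mul1r.
  by rewrite gtr0_norm ?invr_gt0.
have A'2 : `|A'| <= 2.
  apply: le_trans (ler_normB _ _) _.
  by rewrite s1 [leRHS](_ : _ = 1 + 1)// lerD2l normr_tanh_le1.
have B2 : `|mf_defect h x| <= 2.
  apply: le_trans (ler_normB _ _) _.
  by rewrite [leRHS](_ : _ = 1 + 1)// lerD ?normr_tanh_le1 ?normr_magn_le1.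
have dA : `|A - A'| <= beta / N%:R.
  have -> : A - A' = tanh (beta * y + h) - tanh (beta * x + h)
      by rewrite /A /A'; ring.
  apply: le_trans (tanh_lipschitz _ _) _.
  have -> : beta * y + h - (beta * x + h) = - (beta * (x - y)) by ring.
  by rewrite normrN normrM xy ger0_norm.
have dB : `|mf_defect h x - mf_defect h y| <= (1 + beta) / N%:R.
  by rewrite -xy; exact: mf_defect_lipschitz.
have -> : A * mf_defect h x = A' * mf_defect h y +
   ((A - A') * mf_defect h x + A' * (mf_defect h x - mf_defect h y)) by ring.
rewrite lerD2l; apply: le_trans (ler_norm _) _;
  apply: le_trans (ler_normD _ _) _.
rewrite !normrM.
have -> : (2 + 4 * beta) / N%:R =
    beta / N%:R * 2 + 2 * ((1 + beta) / N%:R) by field; rewrite gt_eqF.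
by apply: lerD; apply: ler_pM.
Qed.

End CurieWeiss.

(** * Concentration of the magnetization *)

Section Concentration.
Context {R : realType}.
Variable beta : R.
Implicit Types (h m : R) (N : nat).
Local Notation cw_E := (cw_E beta).
Local Notation cw_Z := (cw_Z beta).
Local Notation cw_weight := (cw_weight beta).
Local Notation mf_defect := (mf_defect beta).
Local Notation magn := (@magn R _).
Local Notation total_spin := (@total_spin R _).

(** * Comparison with zero field *)

Lemma cw_weightE h N (sigma : config N) :
  cw_weight h sigma = cw_weight 0 sigma * expR (h * total_spin sigma).
Proof. by rewrite /cw_weight mul0r addr0 expRD. Qed.

Lemma sum_cw_weight0_total_spin N :
  \sum_(sigma : config N) cw_weight 0 sigma * total_spin sigma = 0.
Proof.
set s := \sum_(sigma : config N) _; suff : s = - s by lra.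
rewrite {1}/s (reindex_inj (@flip_inj N)) -sumrN; apply: eq_bigr => sigma _.
by rewrite /cw_weight !mul0r !addr0 total_spin_flip sqrrN mulrN.
Qed.

(** Use [1 + t <= exp t] with [t = h * total_spin sigma], whose mean at zero field is zero. *)
Lemma cw_Z_ge h N : cw_Z 0 N <= cw_Z h N.
Proof.
have -> : cw_Z 0 N = \sum_(sigma : config N)
    cw_weight 0 sigma * (1 + h * total_spin sigma).
  under eq_bigr do rewrite mulrDr mulr1 mulrCA.
  by rewrite big_split/= -mulr_sumr sum_cw_weight0_total_spin mulr0 addr0.
apply: ler_sum => sigma _; rewrite [leRHS]cw_weightE.
by rewrite ler_pM2l ?cw_weight_gt0 ?expR_ge1Dx.
Qed.

(** The exponential undoes the field, leaving the ratio [cw_Z 0 N / cw_Z h N]. For [h > 0] this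
    bounds the weight of negative magnetizations. *)
Lemma cw_E_expR_le1 h N :
  cw_E h (fun sigma : config N => expR (- (h * total_spin sigma))) <= 1.
Proof.
rewrite /cw_E ler_pdivrMr ?cw_Z_gt0// mul1r.
under eq_bigr do rewrite cw_weightE -mulrA expRxMexpNx_1 mulr1.
exact: cw_Z_ge.
Qed.

(** Pointwise [S <= S * exp (h * S)] for [h >= 0], and [S] has mean zero at zero field. *)
Lemma cw_E_magn_ge0 h N : 0 <= h ->
    0 <= cw_E h (fun sigma : config N => magn sigma).
Proof.
move=> h0; rewrite /cw_E mulr_ge0 ?invr_ge0 ?(ltW (cw_Z_gt0 _ _ _))//.
under eq_bigr do rewrite /magn mulrA.
rewrite -mulr_suml mulr_ge0 ?invr_ge0//.
rewrite -[leLHS](sum_cw_weight0_total_spin N); apply: ler_sum => sigma _.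
rewrite [in leRHS]cw_weightE -mulrA ler_pM2l ?cw_weight_gt0//.
set S := total_spin sigma.
have := expR_ge1Dx (h * S); have := expR_gt0 (h * S).
have [S0|S0] := leP 0 S; first by have := mulr_ge0 h0 S0; nra.
have : expR (h * S) <= 1 by rewrite expR_le1; nra.
nra.
Qed.

Lemma sum_expR_total_spin y N :
  \sum_(sigma : config N) expR (y * total_spin sigma) =
  (expR y + expR (- y)) ^+ N.
Proof.
under eq_bigr do rewrite mulr_sumr expR_sum.
rewrite -(bigA_distr_bigA (fun (_ : 'I_N) b => expR (y * spin R b))).
rewrite prodr_const card_ord; congr (_ ^+ _).
by rewrite big_bool/= mulr1 mulrN1.
Qed.

(* Replacing [S ^ 2] by its tangent at [N y / beta] gives [Z >= (2 q) ^ N] for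
   some [q > 1], whereas [E (exp (- beta N x ^ 2 / 2)) = 2 ^ N / Z]; Jensen's
   inequality then bounds [E (x ^ 2)] from below. *)
Lemma cw_E_sqr_magn_ge : 1 < beta ->
    exists2 c : R, 0 < c & forall N, (0 < N)%N ->
  c <= cw_E 0 (fun sigma : config N => magn sigma ^+ 2).
Proof.
move=> beta_gt1; have beta_gt0 : 0 < beta by lra.
(* Per site the tangent contributes [- y ^ 2 / (2 * beta)], which is [- z] for this choice of
   [y]. *)
pose z := (beta - 1) / (2 * beta).
pose y := Num.sqrt (beta - 1).
have y2 : y ^+ 2 = beta - 1 by rewrite sqr_sqrtr//; lra.
pose q := (expR y + expR (- y)) / 2 * expR (- z).
have z1 : 1 - z = (beta + 1) / (2 * beta) by rewrite /z; field; lra.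
(* Since [cosh y >= 1 + y ^ 2 / 2] and [exp (- z) >= 1 - z], [q] is at least
   [(1 + beta) ^ 2 / (4 * beta)], which exceeds 1. *)
have q1 : 1 < q.
  apply: (@lt_le_trans _ _ ((1 + beta) / 2 * (1 - z))).
    rewrite z1 mulf_div -subr_gt0.
    rewrite (_ : _ - 1 = (beta - 1) ^+ 2 / (4 * beta)); last by field; lra.
    by rewrite divr_gt0 ?exprn_gt0 ?mulr_gt0//; lra.
  have := sqr_le_expRDN y; rewrite y2 => h1.
  have := expR_ge1Dx (- z) => h2.
  by apply: ler_pM; [lra|rewrite z1 divr_ge0//; lra|lra|lra].
have lnq0 : 0 < ln q by rewrite ln_gt0.
exists (2 / beta * ln q) => [|N N0]; first by rewrite mulr_gt0 ?divr_gt0//; lra.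
have NR : 0 < N%:R :> R by rewrite ltr0n.
have Nneq : N%:R != 0 :> R by rewrite gt_eqF.
have bneq : beta != 0 by rewrite gt_eqF.
have Z_ge : 2 ^+ N * q ^+ N <= cw_Z 0 N.
  have -> : 2 ^+ N * q ^+ N = expR (- (N%:R * z)) * (expR y + expR (- y)) ^+ N.
    by rewrite -mulrN expRM_natl -!exprMn /q; congr (_ ^+ _); field.
  rewrite -sum_expR_total_spin mulr_sumr; apply: ler_sum => sigma _.
  rewrite -expRD /cw_weight mul0r addr0 ler_expR -subr_ge0.
  set S := total_spin sigma.
  rewrite (_ : _ - _ = beta / (2 * N%:R) * (S - N%:R * y / beta) ^+ 2).
    by rewrite mulr_ge0 ?sqr_ge0 ?divr_ge0 ?mulr_ge0// ltW.
  rewrite /z -y2; field; rewrite bneq/=; lra.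
have E_le : cw_E 0 (fun sigma : config N =>
    expR (- (beta * N%:R / 2 * magn sigma ^+ 2))) <= q ^- N.
  rewrite /cw_E ler_pdivrMr ?cw_Z_gt0//.
  rewrite (eq_bigr (fun=> 1)) => [|sigma _]; last first.
    rewrite /cw_weight -expRD mul0r addr0 -[RHS]expR0; congr expR.
    by rewrite /magn; field; rewrite Nneq.
  rewrite sumr_const card_ffun card_bool card_ord.
  rewrite mulrC ler_pdivlMr ?exprn_gt0//; last lra.
  by rewrite natrX.
(* Jensen's inequality, obtained from the tangent line of [exp] at [- N * ln q]. *)
have : q ^- N * (1 - (beta * N%:R / 2) *
      cw_E 0 (fun sigma : config N => magn sigma ^+ 2) + N%:R * ln q) <= q ^- N.
  apply: le_trans E_le.
  rewrite -[X in q ^- N * (X - _ + _)](cw_E_cst beta 0 N).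
  rewrite -mulNr -cw_EZ -cw_ED -[X in _ + X](cw_E_cst beta 0 N) -cw_ED -cw_EZ.
  apply: ler_cw_E => sigma.
  set t := - (beta * N%:R / 2 * magn sigma ^+ 2).
  have -> : expR t = q ^- N * expR (t + N%:R * ln q).
    rewrite [in RHS]expRD expRM_natl lnK ?posrE; last lra.
    by rewrite mulrCA mulVf ?mulr1// expf_neq0// gt_eqF//; lra.
  rewrite ler_pM2l ?invr_gt0 ?exprn_gt0//; last lra.
  by apply: le_trans (expR_ge1Dx _); rewrite mulNr -/t addrA.
rewrite -[leRHS]mulr1 ler_pM2l ?invr_gt0 ?exprn_gt0//; last lra.
set e := cw_E _ _ => he.
rewrite mulrAC ler_pdivrMr// -(ler_pM2l NR); lra.
Qed.

(** Compare tanh with the line through the origin and [(y0, m)], where [y0 = beta * m + h]. By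
    concavity it lies above that line before [y0] and below it after, and the defect computed with
    the line instead of tanh is exactly [h / y0 * (x - m)]. *)
Lemma mf_defect_slope h m (x : R) : 0 < beta -> 0 < h -> 0 <= m ->
    m = tanh (beta * m + h) ->
  0 <= beta * x + h ->
  (x - m) ^+ 2 <= ((beta * m + h) / h) ^+ 2 * mf_defect h x ^+ 2.
Proof.
move=> beta_gt0 h0 m0 mE; rewrite /mf_defect.
set y0 := beta * m + h in mE *; set y := beta * x + h => y_ge0.
have y00 : 0 < y0 by rewrite ltr_wpDl ?mulr_ge0// ltW.
rewrite -exprMn.
have le_sqr (a b : R) : 0 <= a <= b \/ b <= a <= 0 -> a ^+ 2 <= b ^+ 2.
  by case=> /andP[? ?]; nra.
apply: le_sqr.
have [yy0|yy0|yy0] := ltgtP y y0.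
- right.
  have T : m * y <= tanh y * y0.
    have [y0'|y0'|<-] := ltgtP 0 y; [|lra|by rewrite mulr0 tanh0 mul0r].
    by rewrite [in leLHS]mE ltW// ltr_tanh_slope.
  apply/andP; split; last by rewrite /y /y0 in yy0; nra.
  rewrite mulrAC ler_pdivrMr//; rewrite /y /y0 in T *; lra.
- left; have T : tanh y * y0 <= m * y.
    by rewrite [in leRHS]mE ltW// ltr_tanh_slope.
  apply/andP; split; first by rewrite /y /y0 in yy0; nra.
  rewrite mulrAC ler_pdivlMr//; rewrite /y /y0 in T *; lra.
- have -> : x = m.
    by rewrite /y /y0 in yy0; apply: (@mulfI _ beta); [rewrite gt_eqF|lra].
  by left; rewrite yy0 -mE subrr mulr0 lexx.
Qed.

Lemma cw_E_concentration_le h m N : 0 < beta -> (0 < N)%N -> 0 < h -> 0 <= m ->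
    m = tanh (beta * m + h) ->
  cw_E h (fun sigma : config N => (magn sigma - m) ^+ 2) <=
  (((beta * m + h) / h) ^+ 2 * (2 + 4 * beta) + 4 * beta / h ^+ 2) / N%:R.
Proof.
move=> beta_gt0 N0 h0 m0 mE; have NR : 0 < N%:R :> R by rewrite ltr0n.
set C := (_ / h) ^+ 2.
(* Where [beta * x + h < 0], [exp (- (h * N * x))] exceeds [exp (N * h ^ 2 / beta)]; [D] turns this
   into the bound 4 on [(x - m) ^ 2]. *)
pose D := 4 * expR (- (N%:R * h ^+ 2 / beta)).
apply: (@le_trans _ _
  (C * cw_E h (fun sigma : config N => mf_defect h (magn sigma) ^+ 2)
   + D * cw_E h (fun sigma : config N => expR (- (h * total_spin sigma))))).
  rewrite -!cw_EZ -cw_ED; apply: ler_cw_E => sigma.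
  set x := magn sigma.
  have D0 : 0 <= D * expR (- (h * total_spin sigma)).
    by rewrite !mulr_ge0 ?expR_ge0.
  have [xh|xh] := leP 0 (beta * x + h).
    by rewrite -[leLHS]addr0 lerD// mf_defect_slope.
  apply: (@le_trans _ _ 4).
    have := @normr_magn_le1 R _ sigma; rewrite -/x ler_norml => /andP[x1 x2].
    have := normr_tanh_le1 (beta * m + h).
    rewrite -mE ler_norml => /andP[m1 m2].
    nra.
  rewrite -[leLHS]add0r lerD//; first by apply: mulr_ge0; exact: sqr_ge0.
  rewrite /D -mulrA ler_peMr// -expRD -[leLHS]expR0 ler_expR.
  have -> : total_spin sigma = N%:R * x.
    by rewrite /x /magn mulrC divfK// gt_eqF.
  rewrite (_ : _ + _ = - (N%:R * h / beta * (beta * x + h))); last first.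
    by field; lra.
  by rewrite oppr_ge0 mulr_ge0_le0// ?divr_ge0 ?mulr_ge0// ltW.
rewrite mulrDl lerD//.
  rewrite -mulrA ler_wpM2l ?sqr_ge0// cw_E_mf_defect_le// ltW//.
apply: (@le_trans _ _ D).
  by rewrite -[leRHS]mulr1 ler_wpM2l ?mulr_ge0 ?expR_ge0// cw_E_expR_le1.
(* The exponentially small term is weakened to order [1 / N] through [exp (- t) <= 1 / t]. *)
rewrite /D -!(mulrA 4) ler_wpM2l// expRN -[leRHS]invrK.
rewrite lef_pV2 ?posrE ?expR_gt0//; last first.
  by rewrite !(mulr_gt0, invr_gt0, exprn_gt0).
have le1 := expR_ge1Dx (N%:R * h ^+ 2 / beta).
rewrite [leLHS](_ : _ = N%:R * h ^+ 2 / beta); first lra.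
by field; rewrite !gt_eqF.
Qed.

Lemma cvg_to0_of_le (u : nat -> R) (C : R) :
  (forall n, 0 <= u n <= C / n.+1%:R) -> u n @[n --> \oo] --> (0 : R).
Proof.
move=> H; apply: (@squeeze_cvgr _ _ _ _ (cst 0) (fun n => C * harmonic n)).
- exact/nearW/H.
- exact: cvg_cst.
- by rewrite -[X in _ --> X](mulr0 C); apply: cvgMl_tmp; exact: cvg_harmonic.
Qed.

(** Mean-square convergence, which for the bounded magnetization amounts to convergence in
    probability. *)
Definition cw_concentrates h m :=
  cw_E h (fun sigma : config n.+1 => (magn sigma - m) ^+ 2)
    @[n --> \oo] --> (0 : R).

Lemma cw_concentratesN h m :
    cw_concentrates (- h) (- m) <-> cw_concentrates h m.
Proof.
rewrite /cw_concentrates.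
suff -> : (fun n =>
    cw_E (- h) (fun sigma : config n.+1 => (magn sigma - (- m)) ^+ 2))
  = (fun n => cw_E h (fun sigma : config n.+1 => (magn sigma - m) ^+ 2)) by [].
apply/funext => n; rewrite cw_E_flip; apply: eq_cw_E => sigma.
by rewrite magn_flip; ring.
Qed.

Lemma cw_concentrates_pos h m : 0 < beta -> 0 < h -> 0 <= m ->
    m = tanh (beta * m + h) ->
  cw_concentrates h m.
Proof.
move=> beta_gt0 h0 m0 mE.
set C := ((beta * m + h) / h) ^+ 2 * (2 + 4 * beta) + 4 * beta / h ^+ 2.
apply: (@cvg_to0_of_le _ C) => n.
rewrite cw_E_concentration_le// andbT; apply: cw_E_ge0 => sigma; exact: sqr_ge0.
Qed.

(** The magnetization has nonnegative mean, so a negative [m] would keep its mean-square distance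
    from [m] above [m ^ 2]. *)
Lemma cw_concentrates_ge0 h m : 0 <= h -> cw_concentrates h m -> 0 <= m.
Proof.
move=> h0 cv; rewrite leNgt; apply/negP => m0.
have : m ^+ 2 <= 0.
  apply: (cvgr_to_ge cv); apply: nearW => n.
  apply: le_trans (sqr_cw_E_le _ _ _).
  rewrite cw_ED cw_E_cst; have := cw_E_magn_ge0 n.+1 h0; nra.
nra.
Qed.

(** The squared defect at [m] is at most twice the squared defect at the magnetization plus [L]
    times the squared distance, and both have vanishing expectation. [L] is twice the squared
    Lipschitz constant of the defect. *)
Lemma cw_concentrates_mean_field h m : 0 < beta -> cw_concentrates h m ->
    m = tanh (beta * m + h).
Proof.
move=> beta_gt0 cv; apply/eqP;
  rewrite -subr_eq0 -[_ - _]/(mf_defect h m) -sqrf_eq0 eq_le sqr_ge0 andbT.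
have c0 : cw_E h (fun sigma : config n.+1 => mf_defect h (magn sigma) ^+ 2)
    @[n --> \oo] --> (0 : R).
  apply: (@cvg_to0_of_le _ (2 + 4 * beta)) => n.
  rewrite cw_E_mf_defect_le//; last exact: ltW.
  by rewrite andbT; apply: cw_E_ge0 => s; exact: sqr_ge0.
pose L := 2 * (1 + beta) ^+ 2.
have c1 : (2 * cw_E h (fun sigma : config n.+1 => mf_defect h (magn sigma) ^+ 2)
  + L * cw_E h (fun sigma : config n.+1 => (magn sigma - m) ^+ 2))
    @[n --> \oo] --> (2 * 0 + L * 0 : R).
  by apply: cvgD; apply: cvgMl_tmp.
rewrite !mulr0 addr0 in c1.
apply: (cvgr_to_ge c1); apply: nearW => n.
rewrite -!cw_EZ -cw_ED -[leLHS](cw_E_cst beta h n.+1); apply: ler_cw_E => sigma.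
set x := magn sigma.
have := mf_defect_lipschitz h x m (ltW beta_gt0).
rewrite -(ler_sqr (normr_nneg _)) ?nnegrE ?mulr_ge0//; last lra.
rewrite exprMn !real_normK ?num_real// /L -(mulrA 2).
set a := mf_defect h x; set b := mf_defect h m; set K := (1 + beta) ^+ 2 * _.
by have := sqr_ge0 (2 * a - b); nra.
Qed.

(** The product [h * m] encodes equal strict signs, a condition invariant under the global flip,
    which reduces [h < 0] to [h > 0]. *)
Lemma cw_concentratesP h m : 1 < beta ->
  cw_concentrates h m <-> m = tanh (beta * m + h) /\ 0 < h * m.
Proof.
move=> beta_gt1; have beta_gt0 : 0 < beta by lra.
have pos h' m' : 0 < h' ->
    cw_concentrates h' m' <-> m' = tanh (beta * m' + h') /\ 0 < h' * m'.
  move=> h0; split=> [cv|[mE hm]]; last first.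
    by apply: cw_concentrates_pos => //; rewrite pmulr_rgt0// in hm; exact: ltW.
  have mE := cw_concentrates_mean_field beta_gt0 cv; split=> //.
  have m0 := cw_concentrates_ge0 (ltW h0) cv.
  by rewrite mulr_gt0// mE tanh_gt0// ltr_wpDl// mulr_ge0// ltW.
have [h0|h0|<-] := ltgtP 0 h; first exact: pos.
  rewrite -cw_concentratesN; rewrite -oppr_gt0 in h0; rewrite pos// mulrNN.
  have -> : beta * - m - h = - (beta * m + h) by ring.
  rewrite tanhN; split=> -[e ?]; split=> //; first exact: oppr_inj.
  by rewrite {1}e.
(* At zero field the flip forces [m = 0], against the uniform lower bound on the second moment. *)
split=> [cv|[_]]; last by rewrite mul0r ltxx.
have m0 : m = 0.
  apply/eqP; rewrite eq_le (cw_concentrates_ge0 _ cv)// andbT.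
  by rewrite -oppr_ge0 (@cw_concentrates_ge0 0)// -oppr0 cw_concentratesN.
have [c c0 cE] := cw_E_sqr_magn_ge beta_gt1.
suff : c <= 0 by rewrite leNgt c0.
apply: (cvgr_to_ge cv); apply: nearW => n.
by rewrite m0; under eq_cw_E do rewrite subr0; exact: cE.
Qed.

End Concentration.

(** * Random fields conditionally on the spins *)

Section Morita.
Context {R : realType}.
Variables b lambda : R.
Local Notation spin := (spin R).
Local Notation magn := (@magn R _).

Definition field_mean (s : bool) : R := tanh (lambda + b * spin s).

(* The conditional probability of [eta i = e] given [sigma i = s]. *)
Definition field_law (s e : bool) : R := (1 + spin e * field_mean s) / 2.

(** As a function of [s] in {-1, 1}, [ln (2 * cosh (lambda + b * s))] is affine: this is its slope,
    and [field_cst] is the exponential of its constant term. *)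
Definition induced_field : R :=
  (ln (expR (lambda + b) + expR (- (lambda + b))) -
   ln (expR (lambda - b) + expR (- (lambda - b)))) / 2.

Definition field_cst : R := expR (
  (ln (expR (lambda + b) + expR (- (lambda + b))) +
   ln (expR (lambda - b) + expR (- (lambda - b)))) / 2).

Lemma field_cst_gt0 : 0 < field_cst. Proof. exact: expR_gt0. Qed.

Lemma expR_field s e : expR ((lambda + b * spin s) * spin e) =
  field_cst * expR (induced_field * spin s) * field_law s e.
Proof.
rewrite /field_cst /induced_field -expRD /field_law /field_mean.
set y := lambda + b * spin s.
have -> : (ln (expR (lambda + b) + expR (- (lambda + b))) +
      ln (expR (lambda - b) + expR (- (lambda - b)))) / 2 +
     (ln (expR (lambda + b) + expR (- (lambda + b))) -
      ln (expR (lambda - b) + expR (- (lambda - b)))) / 2 * spin s =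
    ln (expR y + expR (- y)).
  by rewrite /y; case: s {y} => /=; rewrite ?mulr1 ?mulrN1; field.
rewrite lnK ?posrE ?expRDN_gt0// /tanh.
by case: e => /=; rewrite ?mulr1 ?mulrN1; field; rewrite gt_eqF ?expRDN_gt0.
Qed.

Lemma sum_field_law s : \sum_e field_law s e = 1.
Proof. by rewrite big_bool /field_law /=; field. Qed.

Lemma sum_spin_field_law s : \sum_e spin e * field_law s e = field_mean s.
Proof. by rewrite big_bool /field_law /=; field. Qed.

Lemma normr_field_mean_le1 s : `|field_mean s| <= 1.
Proof. exact: normr_tanh_le1. Qed.

Lemma field_law_ge0 s e : 0 <= field_law s e.
Proof.
rewrite /field_law divr_ge0//; have := normr_field_mean_le1 s.
by rewrite ler_norml; case: e => /=; lra.
Qed.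

Lemma field_law_le1 s e : field_law s e <= 1.
Proof.
rewrite /field_law; have := normr_field_mean_le1 s.
by rewrite ler_norml; case: e => /=; lra.
Qed.

Definition mean_offset : R := (tanh (lambda + b) + tanh (lambda - b)) / 2.
Definition mean_slope : R := (tanh (lambda + b) - tanh (lambda - b)) / 2.

Lemma field_meanE s : field_mean s = mean_offset + mean_slope * spin s.
Proof.
rewrite /field_mean /mean_offset /mean_slope.
by case: s => /=; rewrite ?mulr1 ?mulrN1; field.
Qed.

Lemma mean_slope_gt0 : 0 < b -> 0 < mean_slope.
Proof. by move=> b0; rewrite divr_gt0// subr_gt0 ltr_tanh//; lra. Qed.

Definition mean_field_avg N (sigma : config N) : R :=
  (\sum_(i < N) field_mean (sigma i)) / N%:R.

Lemma mean_field_avgE N (sigma : config N) : (0 < N)%N ->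
  mean_field_avg sigma = mean_offset + mean_slope * magn sigma.
Proof.
move=> N0; rewrite /mean_field_avg; under eq_bigr do rewrite field_meanE.
rewrite big_split/= sumr_const card_ord -mulr_sumr -[X in X + _]mulr_natr.
by rewrite /magn /total_spin; field; rewrite pnatr_eq0 -lt0n.
Qed.

(** Given the spins the fields are independent, and each field beyond the first [N0] sums out to
    1. *)
Lemma sum_field_law_first_fields n N0 (sigma : config n.+1)
    (f : config N0 -> R) :
    (N0 <= n.+1)%N ->
  \sum_(eta : config n.+1) (\prod_(i < n.+1) field_law (sigma i) (eta i))
     * f (first_fields N0 eta) =
  \sum_(xi : config N0)
    f xi * \prod_(j < N0) field_law (sigma (inord j)) (xi j).
Proof.
move=> N0n; rewrite (partition_big (@first_fields N0 n) predT)//=.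
apply: eq_bigr => xi _.
rewrite (eq_bigr (fun eta : config n.+1 =>
  f xi * \prod_(i < n.+1) field_law (sigma i) (eta i))); last first.
  by move=> eta /eqP ->; rewrite mulrC.
rewrite -mulr_sumr; congr (_ * _).
(* The fibre of [first_fields] over [xi] is a product set: coordinates below [N0] are prescribed,
   the others free. The sum over it therefore factorizes. *)
pose Q (i : 'I_n.+1) :=
  [pred e | if insub (i : nat) is Some j then e == xi j else true].
have FQ (eta : config n.+1) : (first_fields N0 eta == xi) = (eta \in family Q).
  apply/eqP/familyP => [xiE i|etaQ].
    rewrite inE/= -xiE; case: insubP => // j _ ji; rewrite ffunE ji; apply/eqP.
    by congr (eta _); apply: val_inj; rewrite /= inordK.
  apply/ffunP => j; rewrite ffunE; have := etaQ (inord j); rewrite inE.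
  rewrite inordK; last exact: leq_trans (ltn_ord j) N0n.
  by rewrite valK => /eqP.
rewrite (eq_bigl _ _ FQ).
rewrite -(bigA_distr_big_dep Q (fun i e => field_law (sigma i) e)).
rewrite (bigID (fun i : 'I_n.+1 => (i < N0)%N))/= [X in _ * X]big1 ?mulr1;
  last first.
  move=> i iN0; rewrite -(sum_field_law (sigma i)); apply: eq_bigl => e.
  by rewrite insubN.
pose G (k : nat) := if insub k is Some j
  then field_law (sigma (inord k)) (xi j) else 1.
rewrite (eq_bigr (fun i : 'I_n.+1 => G i)).
  rewrite -(big_ord_widen n.+1 G N0n); apply: eq_bigr => j _.
  by rewrite /G valK.
move=> i iN0; rewrite /G insubT/= inord_val.
by rewrite (big_pred1 (xi (Ordinal iN0))).
Qed.

(** * Replacing one site by the average over all sites *)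

Section Coupling.
Variables beta h : R.
Local Notation cw_E := (cw_E beta h).

(* [fields_pmf k xi sigma] is the conditional probability, given [sigma], that
   the first [k] fields take the values [xi 0, ..., xi k.-1]. *)
Definition fields_pmf n k (xi : nat -> bool) (sigma : config n.+1) : R :=
  \prod_(i < k) field_law (sigma (inord i)) (xi i).

Lemma fields_pmf_ge0 n k xi (sigma : config n.+1) : 0 <= fields_pmf k xi sigma.
Proof. by apply: prodr_ge0 => i _; exact: field_law_ge0. Qed.

Lemma fields_pmf_le1 n k xi (sigma : config n.+1) : fields_pmf k xi sigma <= 1.
Proof.
apply: prodr_ile1 => i _; rewrite field_law_ge0; exact: field_law_le1.
Qed.

(** The transposition of [k] and [j] fixes the sites below [k], the only ones that [fields_pmf k]
    reads. *)
Lemma cw_E_fields_pmf_mean n k xi (j : 'I_n.+1) : (k <= j)%N ->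
  cw_E (fun sigma : config n.+1 =>
    fields_pmf k xi sigma * field_mean (sigma j)) =
  cw_E (fun sigma : config n.+1 =>
    fields_pmf k xi sigma * field_mean (sigma (inord k))).
Proof.
move=> kj; rewrite -(cw_E_transpose _ _ (inord k) j); apply: eq_cw_E => sigma.
rewrite ffunE tpermR; congr (_ * _); apply: eq_bigr => i _; congr field_law.
have kn : (k < n.+1)%N := leq_ltn_trans kj (ltn_ord j).
have ik := ltn_ord i.
rewrite ffunE tpermD//; apply/eqP => /(congr1 val); rewrite /= ?inordK//.
- by move=> e; rewrite -e ltnn in ik.
- exact: ltn_trans kn.
- by move=> e; rewrite e leqNgt ik in kj.
- exact: ltn_trans kn.
Qed.

Lemma normr_cw_E_fields_pmf_mean_le1 n k xi (j : 'I_n.+1) :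
  `|cw_E (fun sigma : config n.+1 =>
    fields_pmf k xi sigma * field_mean (sigma j))| <= 1.
Proof.
have mean_le (sigma : config n.+1) :
    -1 <= fields_pmf k xi sigma * field_mean (sigma j) <= 1.
  rewrite -ler_norml normrM ger0_norm ?fields_pmf_ge0//.
  by rewrite mulr_ile1 ?fields_pmf_ge0 ?fields_pmf_le1 ?normr_field_mean_le1.
rewrite ler_norml -[X in X <= _](cw_E_cst beta h n.+1).
rewrite -[X in _ && (_ <= X)](cw_E_cst beta h n.+1).
by apply/andP; split; apply: ler_cw_E => sigma; have /andP[] := mean_le sigma.
Qed.

(** In the average over [j], all sites [j >= k] give the same expectation by exchangeability; each
    of the at most [k] others deviates by at most 2. *)
Lemma cw_E_fields_pmf_mean_le n k xi :
  `|cw_E (fun sigma : config n.+1 =>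
      fields_pmf k xi sigma * field_mean (sigma (inord k)))| <=
  `|cw_E (fun sigma : config n.+1 =>
    fields_pmf k xi sigma * mean_field_avg sigma)|
    + 2 * k%:R / n.+1%:R.
Proof.
set w := cw_E (fun sigma => _ * mean_field_avg sigma).
set t := cw_E _.
have NR : 0 < n.+1%:R :> R by rewrite ltr0n.
pose T (j : 'I_n.+1) :=
  cw_E (fun sigma : config n.+1 =>
    fields_pmf k xi sigma * field_mean (sigma j)).
have wE : w = t + (\sum_(j < n.+1 | (j < k)%N) (T j - t)) / n.+1%:R.
  have -> : w = (n.+1%:R)^-1 * \sum_(j < n.+1) T j.
    rewrite /w /T -cw_E_sum -cw_EZ; apply: eq_cw_E => sigma.
    by rewrite /mean_field_avg mulrA mulrC mulr_sumr.
  have -> : \sum_(j < n.+1 | (j < k)%N) (T j - t) = \sum_(j < n.+1) (T j - t).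
    rewrite [RHS](bigID (fun j : 'I_n.+1 => (j < k)%N))/=.
    rewrite [X in _ = _ + X]big1 ?addr0//.
    by move=> j; rewrite -leqNgt => kj; rewrite /T cw_E_fields_pmf_mean// subrr.
  by rewrite sumrB sumr_const card_ord -mulr_natr; field; rewrite gt_eqF.
have -> : t = w - (\sum_(j < n.+1 | (j < k)%N) (T j - t)) / n.+1%:R
    by rewrite wE addrK.
apply: le_trans (ler_normB _ _) _; rewrite lerD2l.
rewrite normrM normfV normr_nat ler_pM2r ?invr_gt0//.
apply: le_trans (ler_norm_sum _ _ _) _.
apply: (@le_trans _ _ (\sum_(j < n.+1 | (j < k)%N) 2)).
  apply: ler_sum => j _; apply: le_trans (ler_normB _ _) _.
  by rewrite [leRHS](_ : _ = 1 + 1)// lerD// normr_cw_E_fields_pmf_mean_le1.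
rewrite sumr_const -[leLHS]mulr_natr ler_pM2l// ler_nat.
have [kn|/ltnW nk] := leqP k n.+1; last first.
  by apply: leq_trans nk; rewrite -[leqRHS]card_ord max_card.
by rewrite -sum1_card (big_ord_narrow kn) sum1_card card_ord.
Qed.

End Coupling.

Lemma cvg_sqr0 (u : nat -> R) :
  u n ^+ 2 @[n --> \oo] --> (0 : R) -> u n @[n --> \oo] --> (0 : R).
Proof.
move=> u2; apply/cvgr0Pnorm_lt => e e0.
have /cvgr0Pnorm_lt/(_ (e ^+ 2)) := u2; rewrite exprn_gt0// => /(_ isT).
apply: filterS => n; rewrite normrX ltr_pXn2r ?nnegrE// ltW//.
Qed.

(** * Fair-coin limits and vanishing of the average conditional mean *)

Section Limit.
Variables beta h : R.
Local Notation cw_E := (cw_E beta h).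

Lemma cvg_mean_field_avgP : 0 < b ->
  cw_E (fun sigma : config n.+1 => mean_field_avg sigma ^+ 2)
    @[n --> \oo] --> (0 : R)
  <-> cw_concentrates beta h (- (mean_offset / mean_slope)).
Proof.
move=> b_gt0; have s0 := mean_slope_gt0 b_gt0.
have E n : cw_E (fun sigma : config n.+1 => mean_field_avg sigma ^+ 2) =
    mean_slope ^+ 2 * cw_E (fun sigma : config n.+1 =>
      (magn sigma - - (mean_offset / mean_slope)) ^+ 2).
  rewrite -cw_EZ; apply: eq_cw_E => sigma; rewrite mean_field_avgE//.
  by field; rewrite gt_eqF.
rewrite /cw_concentrates; split=> [cv|cv].
  have {}cv : (mean_slope ^- 2 *
     cw_E (fun sigma : config n.+1 => mean_field_avg sigma ^+ 2))
    @[n --> \oo] --> (0 : R).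
    by rewrite -[X in _ --> X](mulr0 (mean_slope ^- 2)); apply: cvgMl_tmp.
  apply: cvg_trans cv; apply: near_eq_cvg; apply: nearW => n /=.
  by rewrite E mulKf// expf_neq0// gt_eqF.
have {}cv : (mean_slope ^+ 2 * cw_E (fun sigma : config n.+1 =>
    (magn sigma - - (mean_offset / mean_slope)) ^+ 2))
    @[n --> \oo] --> (0 : R).
  by rewrite -[X in _ --> X](mulr0 (mean_slope ^+ 2)); apply: cvgMl_tmp.
apply: cvg_trans cv.
by apply: near_eq_cvg; apply: nearW => n /=; rewrite E.
Qed.

(** Induction on [k]: a further field multiplies the probability by [(1 + spin * field_mean) / 2].
    The term with [field_mean] vanishes after replacing it by the average over sites and bounding
    the square of the expectation by the expectation of the square. *)
Lemma cvg_fields_pmf :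
    cw_E (fun sigma : config n.+1 => mean_field_avg sigma ^+ 2)
    @[n --> \oo] --> (0 : R) ->
  forall k xi, cw_E (fun sigma : config n.+1 => fields_pmf k xi sigma)
    @[n --> \oo] --> (2^-1 ^+ k : R).
Proof.
move=> cv k xi.
have w0 j : cw_E (fun sigma : config n.+1 =>
      fields_pmf j xi sigma * mean_field_avg sigma)
    @[n --> \oo] --> (0 : R).
  apply: cvg_sqr0; apply: (squeeze_cvgr _ _ cv); last exact: cvg_cst.
  apply: nearW => n; rewrite sqr_ge0/=; apply: le_trans (sqr_cw_E_le _ _ _) _.
  apply: ler_cw_E => sigma; rewrite exprMn ler_piMl ?sqr_ge0//.
  by rewrite exprn_ile1 ?fields_pmf_ge0 ?fields_pmf_le1.
elim: k => [|k IH].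
  rewrite expr0; apply: cvg_near_cst; apply: nearW => n.
  rewrite -[RHS](cw_E_cst beta h n.+1); apply: eq_cw_E => sigma.
  by rewrite /fields_pmf big_ord0.
have t0 : cw_E (fun sigma : config n.+1 =>
      fields_pmf k xi sigma * field_mean (sigma (inord k)))
    @[n --> \oo] --> (0 : R).
  apply/norm_cvg0P.
  have cv0 : (`|cw_E (fun sigma : config n.+1 =>
        fields_pmf k xi sigma * mean_field_avg sigma)|
      + 2 * k%:R / n.+1%:R)
    @[n --> \oo] --> (0 : R).
    rewrite -[X in _ --> X](_ : `|0 : R| + 2 * k%:R * 0 = 0); last first.
      by rewrite normr0 mulr0 addr0.
    apply: cvgD; first by apply: cvg_norm; exact: w0.
    by apply: cvgMl_tmp; exact: cvg_harmonic.
  apply: (squeeze_cvgr _ _ cv0); last exact: cvg_cst.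
  by apply: nearW => n; rewrite normr_ge0/= cw_E_fields_pmf_mean_le.
have {}t0 : (2^-1 * cw_E (fun sigma : config n.+1 => fields_pmf k xi sigma)
    + spin (xi k) / 2 * cw_E (fun sigma : config n.+1 =>
      fields_pmf k xi sigma * field_mean (sigma (inord k))))
    @[n --> \oo] --> (2^-1 ^+ k.+1 : R).
  rewrite exprS -[X in _ --> X](addr0 (2^-1 * _)) -(mulr0 (spin (xi k) / 2)).
  by apply: cvgD; exact: cvgMl_tmp.
apply: cvg_trans t0; apply: near_eq_cvg; apply: nearW => n /=.
rewrite -!cw_EZ -cw_ED; apply: eq_cw_E => sigma.
rewrite /fields_pmf big_ord_recr/=; set P := \prod_(i < k) _.
by rewrite /field_law; field.
Qed.

(** By exchangeability the second moment of the average is the average over [j] of the expected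
    product of the means at sites 0 and [j]. All [j] other than 0 give the same value, and [j = 0]
    contributes at most [1 / N]. *)
Lemma cvg_pair_mean :
    cw_E (fun sigma : config n.+1 =>
      field_mean (sigma (inord 0)) * field_mean (sigma (inord 1)))
    @[n --> \oo] --> (0 : R) ->
  cw_E (fun sigma : config n.+1 => mean_field_avg sigma ^+ 2)
    @[n --> \oo] --> (0 : R).
Proof.
move=> cv.
have cv0 : (`|cw_E (fun sigma : config n.+1 =>
    field_mean (sigma (inord 0)) * field_mean (sigma (inord 1)))| + n.+1%:R^-1)
    @[n --> \oo] --> (0 : R).
  rewrite -[X in _ --> X](_ : `|0 : R| + 0 = 0); last by rewrite normr0 addr0.
  by apply: cvgD; [exact: cvg_norm|exact: cvg_harmonic].
apply: (squeeze_cvgr _ _ cv0); last exact: cvg_cst.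
(* Two distinct sites exist only from size 2 on. *)
exists 1%N => // -[//|n] _ /=.
rewrite cw_E_ge0 => [|sigma]; last exact: sqr_ge0.
rewrite andTb; set t := cw_E (fun sigma => field_mean _ * _).
have -> : cw_E (fun sigma : config n.+2 => mean_field_avg sigma ^+ 2) =
    (\sum_(j < n.+2) cw_E (fun sigma : config n.+2 =>
      field_mean (sigma ord0) * field_mean (sigma j))) / n.+2%:R.
  have -> : cw_E (fun sigma : config n.+2 => mean_field_avg sigma ^+ 2) =
      cw_E (fun sigma : config n.+2 =>
        field_mean (sigma ord0) * mean_field_avg sigma).
    have avg_transpose i (sigma : config n.+2) :
        mean_field_avg (transpose ord0 i sigma) = mean_field_avg sigma.
      rewrite /mean_field_avg; congr (_ / _).
      rewrite [RHS](reindex_inj (@perm_inj _ (tperm ord0 i))).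
      by apply: eq_bigr => j _; rewrite ffunE.
    rewrite [RHS](_ : _ = (\sum_(i < n.+2) cw_E (fun sigma : config n.+2 =>
        field_mean (sigma i) * mean_field_avg sigma)) / n.+2%:R).
      rewrite -cw_E_sum mulrC -cw_EZ; apply: eq_cw_E => sigma.
      by rewrite -mulr_suml mulrA (mulrC _^-1) expr2.
    rewrite (eq_bigr (fun=> cw_E (fun sigma : config n.+2 =>
        field_mean (sigma ord0) * mean_field_avg sigma))).
      by rewrite sumr_const card_ord -[X in X / _]mulr_natr mulfK ?pnatr_eq0.
    move=> i _; rewrite -(cw_E_transpose _ _ ord0 i); apply: eq_cw_E => sigma.
    by rewrite avg_transpose ffunE tpermR.
  rewrite -cw_E_sum mulrC -cw_EZ; apply: eq_cw_E => sigma.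
  by rewrite -mulr_sumr [RHS]mulrCA [in RHS](mulrC _^-1).
rewrite /harmonic/= ler_pdivrMr// mulrDl mulVf// big_ord_recl addrC.
apply: lerD; last first.
  rewrite -[leRHS](cw_E_cst beta h n.+2); apply: ler_cw_E => sigma.
  apply: le_trans (ler_norm _) _.
  by rewrite normrM mulr_ile1 ?normr_field_mean_le1.
apply: (@le_trans _ _ (\sum_(i < n.+1) `|t|)); last first.
  by rewrite sumr_const card_ord -[leLHS]mulr_natr ler_wpM2l// ler_nat.
apply: ler_sum => j _; apply: le_trans (ler_norm _) _.
rewrite /t -(cw_E_transpose _ _ (inord 1) (lift ord0 j)).
have -> : (inord 0 : 'I_n.+2) = ord0 by apply: val_inj; rewrite /= inordK.
rewrite (eq_cw_E _ _ (g := fun sigma : config n.+2 =>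
  field_mean (sigma ord0) * field_mean (sigma (inord 1))))// => sigma.
rewrite !ffunE tpermR tpermD// -val_eqE/= inordK//.
Qed.

End Limit.

End Morita.

(** * Morita marginals *)

Section MoritaMarginals.
Context {R : realType}.
Variables lambda beta eps h0 : R.
Local Notation b := (beta * eps).
Local Notation h := (beta * h0 + induced_field b lambda).
Local Notation cw_E := (cw_E beta h).
Local Notation field_law := (field_law b lambda).
Local Notation spin := (spin R).

(** Normalizing the field factors site by site yields the conditional laws; the normalizers shift
    the field acting on the spins and leave a constant that cancels against [morita_Z]. *)
Lemma morita_weightE N (sigma eta : config N) :
  morita_weight lambda beta eps h0 sigma eta =
  field_cst b lambda ^+ N * cw_weight beta h sigma
    * \prod_(i < N) field_law (sigma i) (eta i).
Proof.
have -> : cw_weight beta h sigma =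
    expR (beta / (2 * N%:R) * total_spin sigma ^+ 2 +
      beta * h0 * total_spin sigma)
    * \prod_(i < N) expR (induced_field b lambda * spin (sigma i)).
  by rewrite -expR_sum -mulr_sumr -expRD /cw_weight /total_spin; congr expR;
    ring.
have -> : field_cst b lambda ^+ N = \prod_(i < N) field_cst b lambda.
  by rewrite prodr_const card_ord.
rewrite mulrCA -[RHS]mulrA -!big_split/=.
rewrite /morita_weight -/(total_spin sigma).
have -> : beta / (2 * N%:R) * total_spin sigma ^+ 2 +
   beta * (\sum_(i < N) (eps * spin (eta i) + h0) * spin (sigma i)) +
   lambda * (\sum_(i < N) spin (eta i)) =
   beta / (2 * N%:R) * total_spin sigma ^+ 2 + beta * h0 * total_spin sigma
   + \sum_(i < N) (lambda + b * spin (sigma i)) * spin (eta i).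
  rewrite -[LHS]addrA -[RHS]addrA; congr (_ + _).
  rewrite /total_spin !mulr_sumr -!big_split/=; apply: eq_bigr => i _; ring.
rewrite expRD expR_sum; congr (_ * _); apply: eq_bigr => i _.
by rewrite expR_field.
Qed.

Lemma morita_ZE N : morita_Z lambda beta eps h0 N =
  field_cst b lambda ^+ N * cw_Z beta h N.
Proof.
rewrite /morita_Z /cw_Z mulr_sumr; apply: eq_bigr => sigma _.
under eq_bigr do rewrite morita_weightE.
rewrite -mulr_sumr -(bigA_distr_bigA (fun i e => field_law (sigma i) e)).
by rewrite big1 ?mulr1// => i _; exact: sum_field_law.
Qed.

Lemma morita_K_etaE N (eta : config N) : morita_K_eta lambda beta eps h0 eta =
  cw_E (fun sigma => \prod_(i < N) field_law (sigma i) (eta i)).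
Proof.
rewrite /morita_K_eta /morita_K -mulr_suml morita_ZE /cw_E.
under eq_bigr do rewrite morita_weightE -mulrA.
rewrite -mulr_sumr -mulf_div divff ?mul1r//.
by rewrite expf_neq0// gt_eqF// field_cst_gt0.
Qed.

Lemma morita_marginalE n N0 (f : config N0 -> R) : (N0 <= n.+1)%N ->
  \sum_(eta : config n.+1) morita_K_eta lambda beta eps h0 eta * f
    (first_fields N0 eta) =
  cw_E (fun sigma : config n.+1 => \sum_(xi : config N0)
    f xi * \prod_(j < N0) field_law (sigma (inord j)) (xi j)).
Proof.
move=> N0n; under eq_bigr do rewrite morita_K_etaE mulrC -cw_EZ.
rewrite -cw_E_sum; apply: eq_cw_E => sigma.
by rewrite -sum_field_law_first_fields//; apply: eq_bigr => eta _;
  rewrite mulrC.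
Qed.

Lemma iid_marginalE N0 (xi : config N0) : iid_marginal R xi = 2^-1 ^+ N0.
Proof.
rewrite /iid_marginal (eq_bigr (fun=> 2^-1)); last first.
  by move=> i _; rewrite /bernoulli_pmf; case: (xi i) => //; field.
by rewrite prodr_const card_ord.
Qed.

(** Necessity needs only the test function [eta_1 * eta_2], of mean zero under fair coins.
    Sufficiency follows by linearity from convergence of the probability of each [xi]. *)
Lemma weak_cvg_moritaP : 0 < b ->
  weak_cvg_marginals (fun N => morita_K_eta lambda beta eps h0 (N := N))
                     (@iid_marginal R) <->
  cw_concentrates beta h (- (mean_offset b lambda / mean_slope b lambda)).
Proof.
move=> b_gt0; rewrite -cvg_mean_field_avgP//; split=> [cv|cv N0 f].
  apply: cvg_pair_mean.
  pose f (xi : config 2) := spin (xi ord0) * spin (xi (lift ord0 ord0)).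
  have prodE (g : 'I_2 -> bool -> R) :
      \sum_(xi : config 2) f xi * \prod_(j < 2) g j (xi j)
      = \prod_(j < 2) \sum_e spin e * g j e.
    rewrite bigA_distr_bigA; apply: eq_bigr => xi _.
    by rewrite /f !big_ord_recl !big_ord0/=; ring.
  have f0 : \sum_(xi : config 2) iid_marginal R xi * f xi = 0.
    under eq_bigr do rewrite mulrC /iid_marginal.
    rewrite (prodE (fun _ e => bernoulli_pmf 2^-1 e)) big_ord_recl big_bool/=
      /bernoulli_pmf.
    by rewrite (_ : 1 * 2^-1 + _ = 0) ?mul0r//; field.
  have := cv 2%N f; rewrite f0; apply: cvg_trans; apply: near_eq_cvg;
      exists 1%N => // n n1 /=.
  rewrite morita_marginalE//; apply: eq_cw_E => sigma.
  rewrite (prodE (fun j e => field_law (sigma (inord j)) e)).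
  by rewrite !big_ord_recl big_ord0 !sum_spin_field_law mulr1.
have {}cv (xi : config N0) : (f xi * cw_E (fun sigma : config n.+1 =>
    \prod_(j < N0) field_law (sigma (inord j)) (xi j))) @[n --> \oo] -->
    (f xi * 2^-1 ^+ N0 : R).
  apply: cvgMl_tmp.
  (* [xi] is extended to all naturals by [true]; the product reads indices below [N0]. *)
  have := @cvg_fields_pmf _ _ _ _ _ cv N0
    (fun k => if insub k is Some j then xi j else true).
  apply: cvg_trans; apply: near_eq_cvg; apply: nearW => n /=.
  apply: eq_cw_E => sigma; rewrite /fields_pmf; apply: eq_bigr => j _.
  by rewrite valK.
have cvS : (\sum_(xi : config N0) f xi * cw_E (fun sigma : config n.+1 =>
    \prod_(j < N0) field_law (sigma (inord j)) (xi j))) @[n --> \oo] -->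
    (\sum_(xi : config N0) f xi * 2^-1 ^+ N0 : R).
  by apply: cvg_big => [|xi _]; [exact: add_continuous|exact: cv].
rewrite (eq_bigr (fun xi => f xi * 2^-1 ^+ N0)); last first.
  by move=> xi _; rewrite iid_marginalE mulrC.
apply: cvg_trans cvS; apply: near_eq_cvg; exists N0 => // n N0n /=.
rewrite morita_marginalE ?cw_E_sum; last exact: leq_trans N0n _.
by apply: eq_bigr => xi _; rewrite cw_EZ.
Qed.

End MoritaMarginals.

(** * Solvability of the consistency equation *)

Section Threshold.
Context {R : realType}.
Variables beta b : R.
Implicit Types lambda h m y : R.

(** The magnetization at which the average conditional mean of the fields vanishes. *)
Definition target_magn lambda : R :=
  - (mean_offset b lambda / mean_slope b lambda).

Lemma target_magnN lambda : target_magn (- lambda) = - target_magn lambda.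
Proof.
rewrite /target_magn /mean_offset /mean_slope.
have -> : - lambda + b = - (lambda - b) by ring.
rewrite -opprD !tanhN; move: (tanh _) (tanh _) => q p.
have -> : - p - q = - (q + p) by ring.
have -> : - p - - q = q - p by ring.
by rewrite !mulNr.
Qed.

Lemma induced_fieldN lambda : induced_field b (- lambda) =
    - induced_field b lambda.
Proof.
rewrite /induced_field.
have -> : - lambda + b = - (lambda - b) by ring.
rewrite -opprD !opprK [expR (- (lambda - b)) + _]addrC.
rewrite [expR (- (lambda + b)) + _]addrC -mulNr; congr (_ / 2).
by rewrite !opprB.
Qed.

(* [e] stands for [exp (-2 lambda)] *)
Definition field_of (e : R) : R :=
  (ln (1 + expR (2 * b) * e) - ln (expR (2 * b) + e)) / 2.

Lemma induced_fieldE lambda : induced_field b lambda =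
    - field_of (expR (- (2 * lambda))).
Proof.
have pos1 : 0 < 1 + expR (2 * b) * expR (- (2 * lambda)).
  by rewrite addr_gt0// mulr_gt0// expR_gt0.
have pos2 : 0 < expR (2 * b) + expR (- (2 * lambda))
    by rewrite addr_gt0 ?expR_gt0.
rewrite /induced_field /field_of.
have -> : expR (lambda + b) + expR (- (lambda + b)) =
    expR (lambda - b) * (expR (2 * b) + expR (- (2 * lambda))).
  by rewrite mulrDr -!expRD; congr (expR _ + expR _); ring.
have -> : expR (lambda - b) + expR (- (lambda - b)) =
    expR (lambda - b) * (1 + expR (2 * b) * expR (- (2 * lambda))).
  by rewrite mulrDr mulr1 -!expRD; congr (_ + expR _); ring.
by rewrite !lnM ?posrE ?expR_gt0//; ring.
Qed.

Hypothesis b_gt0 : 0 < b.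

Lemma expRB_gt0 : 0 < expR (2 * b) - expR (- (2 * b)).
Proof. by rewrite subr_gt0 ltr_expR; have := b_gt0; lra. Qed.

(** This is [- sinh (2 * lambda) / sinh (2 * b)], by the addition formulas for tanh at [lambda + b]
    and [lambda - b]. *)
Lemma target_magnE lambda : target_magn lambda =
  (expR (- (2 * lambda)) - expR (2 * lambda))
    / (expR (2 * b) - expR (- (2 * b))).
Proof.
rewrite /target_magn /mean_offset /mean_slope !tanhE_sqr.
have := expRB_gt0.
rewrite mulrBr mulrDr expRD expRB !expRN.
have := expR_gt0 (2 * lambda); have := expR_gt0 (2 * b).
set L := expR (2 * lambda); set B := expR (2 * b) => B0 L0 BB.
have B1 : B * B - 1 > 0.
  by rewrite (_ : _ - 1 = (B - B^-1) * B) ?mulr_gt0//; field; rewrite gt_eqF.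
field.
have -> : (L * B - 1) * (L + B) + - (L + -1 * B) * (L * B + 1)
    = 2 * L * (B * B - 1) by ring.
have LB0 : 0 < L * B by rewrite mulr_gt0.
by rewrite !gt_eqF//; [rewrite !mulr_gt0|lra|lra].
Qed.

Lemma field_of_gt0 e : 1 < e -> 0 < field_of e.
Proof.
move=> e1; have B1 : 1 < expR (2 * b) by rewrite expR_gt1 mulr_gt0.
rewrite divr_gt0// subr_gt0 ltr_ln ?posrE; nra.
Qed.

(** With [B = exp (2 * b)], the quotient [(1 + B * e) / (B + e)] increases in [e] because
    [B ^ 2 > 1]. *)
Lemma ler_field_of e f : 0 < e -> e <= f -> field_of e <= field_of f.
Proof.
move=> e0 ef; rewrite /field_of ler_pM2r//.
have B1 : 1 < expR (2 * b) by rewrite expR_gt1 mulr_gt0.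
set B := expR (2 * b) in B1 *.
have [Be Bf] : 0 < B + e /\ 0 < B + f by split; lra.
have Bef : 0 <= (B ^+ 2 - 1) * (f - e) by rewrite mulr_ge0 ?subr_ge0//; nra.
rewrite -!ln_div ?posrE//; [|nra..].
rewrite ler_ln ?posrE ?divr_gt0//; [|nra..].
rewrite ler_pdivrMr// mulrAC ler_pdivlMr//; nra.
Qed.

(* the value of [exp (-2 lambda)] for which [target_magn lambda = tanh y] *)
Definition tilt y : R :=
  let u := tanh y * (expR (2 * b) - expR (- (2 * b))) / 2 in
  u + Num.sqrt (u ^+ 2 + 1).

Lemma sqrt1_gt (u : R) : `|u| < Num.sqrt (u ^+ 2 + 1).
Proof. by rewrite -sqrtr_sqr ltr_sqrt ?ltrDl// ltr_wpDl// sqr_ge0. Qed.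

Lemma tilt_gt0 y : 0 < tilt y.
Proof.
by rewrite /tilt; set u := _ / 2; have := sqrt1_gt u;
  rewrite ltr_norml => /andP[+ _]; lra.
Qed.

(** The equation is the quadratic [e ^ 2 - 2 * u * e - 1 = 0], whose roots have opposite signs;
    [tilt y] is the positive one. *)
Lemma tiltP y e : 0 < e ->
  e - e^-1 = tanh y * (expR (2 * b) - expR (- (2 * b))) <-> e = tilt y.
Proof.
move=> e0; have t0 := tilt_gt0 y.
rewrite /tilt /=; set u := _ / 2.
have -> : tanh y * (expR (2 * b) - expR (- (2 * b))) = 2 * u.
  by rewrite /u; field.
set s := Num.sqrt _.
have s2 : s ^+ 2 = u ^+ 2 + 1 by rewrite sqr_sqrtr// addr_ge0// sqr_ge0.
have s0 : 0 < s by rewrite sqrtr_gt0 ltr_wpDl// sqr_ge0.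
have us : `|u| < s := sqrt1_gt u.
split=> [eu|->].
  have : (e - u) ^+ 2 = s ^+ 2.
    rewrite s2; have : e ^+ 2 - 1 = 2 * u * e.
      by rewrite -eu; field; rewrite gt_eqF.
    by move=> ?; lra.
  move/eqP; rewrite eqf_sqr => /orP[/eqP ?|/eqP ?]; first lra.
  by move: us; rewrite ltr_norml => /andP[]; lra.
have us0 : 0 < u + s by move: us; rewrite ltr_norml => /andP[]; lra.
have -> : (u + s)^-1 = s - u.
  apply: (@mulfI _ (u + s)); first by rewrite gt_eqF.
  by rewrite divff ?gt_eqF//; rewrite mulrDl; lra.
by ring.
Qed.

(** The map [u + sqrt (u ^ 2 + 1)] is increasing: [(t - s) * (t + s) = (v - u) * (v + u)] and
    [|u + v| < s + t]. *)
Lemma ler_tilt y z : y <= z -> tilt y <= tilt z.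
Proof.
move=> yz; rewrite /tilt/=.
set u := tanh y * _ / 2; set v := tanh z * _ / 2.
have uv : u <= v by rewrite ler_pM2r// ler_pM2r ?expRB_gt0// ler_tanh.
have := sqrt1_gt u; have := sqrt1_gt v; rewrite !ltr_norml.
set s := Num.sqrt (u ^+ 2 + 1); set t := Num.sqrt (v ^+ 2 + 1).
have s2 : s ^+ 2 = u ^+ 2 + 1 by rewrite sqr_sqrtr// addr_ge0// sqr_ge0.
have t2 : t ^+ 2 = v ^+ 2 + 1 by rewrite sqr_sqrtr// addr_ge0// sqr_ge0.
move=> /andP[v1 v2] /andP[u1 u2].
nra.
Qed.

Lemma tilt_gt1 y : 0 < y -> 1 < tilt y.
Proof.
move=> y0; rewrite /tilt/=; set u := _ / 2.
have u0 : 0 < u by rewrite divr_gt0// mulr_gt0 ?expRB_gt0// tanh_gt0.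
rewrite -[X in X < _]add0r ltr_leD//.
by rewrite -[X in X <= _]sqrtr1 ler_sqrt ?lerDr ?sqr_ge0// addr_ge0 ?sqr_ge0.
Qed.

(** The value of [beta * h0] belonging to [y = beta * m + h]: [y - beta * tanh y] is the total field
    [h], and [- field_of (tilt y)] is the induced field. *)
Definition critical_curve y : R := y - beta * tanh y + field_of (tilt y).

Lemma continuous_field_of e : 0 < e -> {for e, continuous field_of}.
Proof.
move=> e0; have B0 := expR_gt0 (2 * b); rewrite /field_of.
apply: cvgMr_tmp; apply: cvgB.
  apply: (cvg_comp (fun t : R => 1 + expR (2 * b) * t) (@ln R)).
    by apply: cvgD; [exact: cvg_cst|apply: cvgMl_tmp; exact: cvg_id].
  by apply: continuous_ln; rewrite addr_gt0// mulr_gt0.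
apply: (cvg_comp (fun t : R => expR (2 * b) + t) (@ln R)).
  by apply: cvgD; [exact: cvg_cst|exact: cvg_id].
by apply: continuous_ln; rewrite addr_gt0.
Qed.

Lemma continuous_critical_curve : continuous critical_curve.
Proof.
move=> y; rewrite /critical_curve.
have ct : {for y, continuous (tilt : R -> R)}.
  have cu : {for y, continuous (fun t =>
      tanh t * (expR (2 * b) - expR (- (2 * b))) / 2)}.
    by apply: cvgMr_tmp; apply: cvgMr_tmp; exact: continuous_tanh.
  apply: cvgD => //.
  apply: (continuous_comp (g := Num.sqrt) (f := fun t =>
    (tanh t * (expR (2 * b) - expR (- (2 * b))) / 2) ^+ 2 + 1)).
    by apply: cvgD; [exact: cvgM|exact: cvg_cst].
  exact: sqrt_continuous.
apply: cvgD; first apply: cvgB; first exact: cvg_id.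
  by apply: cvgMl_tmp; exact: continuous_tanh.
apply: (continuous_comp (f := tilt) (g := field_of)) => //.
exact/continuous_field_of/tilt_gt0.
Qed.

Lemma exists_mean_field_fixpoint : 1 < beta ->
    exists2 y, 0 < y & y = beta * tanh y.
Proof.
move=> beta_gt1; pose f y := y - beta * tanh y.
(* At [y1], [y / (1 + y) <= tanh y] gives [beta * tanh y1 >= y1 * 2 * beta / (beta + 1)], above
   [y1]; at [y2], [tanh < 1] suffices. *)
pose y1 := (beta - 1) / 2; pose y2 := beta + 1.
have y12 : y1 <= y2 by rewrite /y1 /y2; lra.
have y10 : 0 < y1 by rewrite /y1; lra.
have f1 : f y1 <= 0.
  have := ler_divD1_tanh y10; rewrite ler_pdivrMr; last lra.
  have := tanh_gt0 y10; rewrite /f /y1; nra.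
have f2 : 0 <= f y2.
  by have := ltr1_tanh y2; rewrite /f /y2; nra.
have [||y] := @IVT R f y1 y2 0 y12.
- apply: continuous_subspaceT => y; apply: cvgB; first exact: cvg_id.
  by apply: cvgMl_tmp; exact: continuous_tanh.
- by rewrite ge_min f1 le_max f2 orbT.
rewrite in_itv/= => /andP[y1y _] fy; exists y; first exact: lt_le_trans y1y.
by move: fy; rewrite /f; lra.
Qed.

(** * The critical curve beyond the positive fixed point *)

Variable ystar : R.
Hypothesis ystar_gt0 : 0 < ystar.
Hypothesis ystarE : ystar = beta * tanh ystar.

Lemma beta_gt0_of_fixpoint : 0 < beta.
Proof. by rewrite -(pmulr_lgt0 _ (tanh_gt0 ystar_gt0)) -ystarE. Qed.

(** By concavity [tanh y / y] decreases, so it crosses [1 / beta] only at [ystar]. *)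
Lemma subr_tanh_gt0E y : 0 < y -> (0 < y - beta * tanh y) = (ystar < y).
Proof.
move=> y0; have beta0 := beta_gt0_of_fixpoint; have ys0 := ystar_gt0.
have ysE := ystarE; have := tanh_gt0 ys0; have := tanh_gt0 y0.
have [ysy|yys|<-] := ltgtP ystar y.
- have := ltr_tanh_slope ys0 ysy; rewrite subr_gt0 => *.
  rewrite -(ltr_pM2r ys0) -mulrA; rewrite {2}ysE; nra.
- have := ltr_tanh_slope y0 yys => *.
  apply/negbTE; rewrite -leNgt subr_le0 -(ler_pM2r ys0) -mulrA {1}ysE; nra.
by move=> _ _; rewrite -ysE subrr ltxx.
Qed.

(** The ratio [(y - beta * tanh y) / y] increases and is nonnegative from [ystar] on, so its
    numerator increases; the term [field_of (tilt y)] is nondecreasing. *)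
Lemma ltr_critical_curve y z : ystar <= y -> y < z ->
    critical_curve y < critical_curve z.
Proof.
move=> ysy yz; have ys0 := ystar_gt0; have y0 := lt_le_trans ys0 ysy.
rewrite /critical_curve ltr_leD//; last first.
  by rewrite ler_field_of ?tilt_gt0// ler_tilt// ltW.
have beta0 := beta_gt0_of_fixpoint.
have fy : 0 <= y - beta * tanh y.
  move: ysy; rewrite le_eqVlt => /predU1P[<-|];
    last by rewrite -subr_tanh_gt0E// => /ltW.
  by rewrite -ystarE subrr.
have sl := ltr_tanh_slope y0 yz.
rewrite -(ltr_pM2r y0).
have : (y - beta * tanh y) * y <= (y - beta * tanh y) * z.
  by rewrite ler_wpM2l// ltW.
nra.
Qed.

Lemma critical_curve_onto (v : R) :
  (exists2 y, ystar < y & v = critical_curve y) <-> critical_curve ystar < v.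
Proof.
split=> [[y ysy ->]|v_gt]; first exact: ltr_critical_curve.
have ys0 := ystar_gt0; have beta0 := beta_gt0_of_fixpoint.
(* As [tanh z < 1] and [field_of (tilt z) > 0], the curve at [z] exceeds [ystar + |v|]. *)
pose z := ystar + `|v| + beta.
have yz : ystar <= z by rewrite /z -addrA lerDl addr_ge0 ?normr_ge0// ltW.
have vz : v <= critical_curve z.
  have z0 : 0 < z := lt_le_trans ys0 yz.
  have := field_of_gt0 (tilt_gt1 z0); rewrite /critical_curve.
  have := ltr1_tanh z; have := ler_norm v; rewrite /z; nra.
have [||y] := @IVT R critical_curve ystar z v yz.
- exact/continuous_subspaceT/continuous_critical_curve.
- by rewrite ge_min (ltW v_gt) le_max vz orbT.
rewrite in_itv/= => /andP[ysy _] fy; exists y => //.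
by rewrite lt_neqAle ysy andbT; apply: contraTneq v_gt => ->; rewrite fy ltxx.
Qed.

Lemma critical_curve_gt0 : 0 < critical_curve ystar.
Proof.
by rewrite /critical_curve -ystarE subrr add0r field_of_gt0// tilt_gt1.
Qed.

Lemma consistent_posP (v : R) :
  (exists2 lambda, target_magn lambda =
      tanh (beta * target_magn lambda + (v + induced_field b lambda)) &
    0 < v + induced_field b lambda /\ 0 < target_magn lambda) <->
  critical_curve ystar < v.
Proof.
have beta0 := beta_gt0_of_fixpoint.
rewrite -critical_curve_onto; split=> [[lambda]|[y ysy vE]].
  set m := target_magn lambda; set h := v + _ => mE [h0 m0].
  set y := beta * m + h in mE.
  have y0 : 0 < y by rewrite addr_gt0// mulr_gt0.
  have hE : h = y - beta * tanh y by rewrite -mE /y; ring.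
  exists y; first by rewrite -subr_tanh_gt0E// -hE.
  have -> : v = h - induced_field b lambda by rewrite /h addrK.
  rewrite induced_fieldE opprK hE /critical_curve; congr (_ + field_of _).
  apply/tiltP; first exact: expR_gt0.
  rewrite -expRN opprK -mE /m target_magnE divfK// gt_eqF//; exact: expRB_gt0.
have t0 := tilt_gt0 y; have y0 := lt_trans ystar_gt0 ysy.
(* Chosen so that [exp (- 2 * lambda)] is [tilt y], which makes the target magnetization
   [tanh y]. *)
pose lambda := - (ln (tilt y) / 2).
have tE : expR (- (2 * lambda)) = tilt y.
  by rewrite /lambda mulrN opprK mulrC divfK// lnK.
have mE : target_magn lambda = tanh y.
  have tV : expR (2 * lambda) = (tilt y)^-1 by rewrite -tE expRN invrK.
  rewrite target_magnE tE tV.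
  by rewrite ((tiltP _ t0).2 erefl) mulfK// gt_eqF// expRB_gt0.
have hE : v + induced_field b lambda = y - beta * tanh y.
  by rewrite vE induced_fieldE tE /critical_curve addrK.
exists lambda; rewrite hE mE; first by rewrite addrC subrK.
by rewrite subr_tanh_gt0E// tanh_gt0.
Qed.

(** Target magnetization and induced field are odd in [lambda], so reversing [lambda] and [v]
    together exchanges the two sign cases. *)
Lemma consistentP (v : R) :
  (exists lambda, target_magn lambda =
      tanh (beta * target_magn lambda + (v + induced_field b lambda)) /\
    0 < (v + induced_field b lambda) * target_magn lambda) <->
  critical_curve ystar < `|v|.
Proof.
rewrite lter_normr; split=> [[lambda [mE]]|/orP[] /consistent_posP].
- have [h0|h0|<-] := ltgtP 0 (v + induced_field b lambda); last first.
  + by rewrite mul0r ltxx.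
  + rewrite nmulr_rgt0// => m0; apply/orP; right; apply/consistent_posP.
    exists (- lambda); rewrite target_magnN induced_fieldN -opprD.
      by rewrite mulrN -opprD tanhN -mE.
    by rewrite !oppr_gt0.
  + rewrite pmulr_rgt0// => m0; apply/orP; left; apply/consistent_posP.
    by exists lambda.
- by move=> [lambda mE [h0 m0]]; exists lambda; split=> //; exact: mulr_gt0.
move=> [lambda mE [h0 m0]]; exists (- lambda).
rewrite target_magnN induced_fieldN; split.
  rewrite (_ : _ + _ = - (beta * target_magn lambda +
    (- v + induced_field b lambda))); last by ring.
  by rewrite tanhN -mE.
by rewrite -[v]opprK -opprD mulrNN; exact: mulr_gt0.
Qed.

End Threshold.

Theorem theorem2p1 (R : realType) (beta eps : R)
    (hbeta : 1 < beta) (heps : 0 < eps) :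
  exists a : R, 0 < a /\
    [set h0 : R | exists lambda : R,
       weak_cvg_marginals (fun N => morita_K_eta lambda beta eps h0 (N := N))
                          (@iid_marginal R)]
    = [set: R] `\` `[- a, a]%classic.
Proof.
have beta0 : 0 < beta by lra.
have b0 : 0 < beta * eps by rewrite mulr_gt0.
have [ystar ystar0 ystarE] := exists_mean_field_fixpoint hbeta.
(* The solvability threshold concerns [|beta * h0|], hence the division by [beta]. *)
exists (critical_curve beta (beta * eps) ystar / beta); split.
  by rewrite divr_gt0// critical_curve_gt0.
apply/seteqP.
have P (h0 : R) : (exists lambda : R,
     weak_cvg_marginals (fun N => morita_K_eta lambda beta eps h0 (N := N))
                          (@iid_marginal R)) <->
   critical_curve beta (beta * eps) ystar / beta < `|h0|.
  rewrite ltr_pdivrMr// -[X in _ < _ * X](gtr0_norm beta0) -normrM (mulrC h0).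
  rewrite -consistentP//; split=> -[lambda H]; exists lambda.
    by apply/(cw_concentratesP _ _ hbeta)/weak_cvg_moritaP.
  by apply/weak_cvg_moritaP => //; apply/cw_concentratesP.
split=> h0 /=.
  by move=> /P; rewrite in_itv/= -ler_norml leNgt => ->.
by move=> [_]; rewrite in_itv/= -ler_norml => /negP; rewrite -ltNge => /P.
Qed.
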